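(* Let $0\le r<\infty$. Suppose that $f\in L^1(\mathbb{R})\cap L^\infty(\mathbb{R})$ is real-valued, even and non-negative. Suppose that $f$ is increasing on $(0,r]$ and decreasing on $[r,\infty)$. Then $f\in S$.
   Context: For $f$ on $\mathbb{R}$ put $f_+(x)=f(x)\chi_{\{x>0\}}$ and $f_-(x)=f(x)\chi_{\{x<0\}}$. The class $S$ is the set of real-valued $f\in L^1(\mathbb{R})\cap L^2(\mathbb{R})$ such that the convolution $f_+*f_-(x)=\int_{\mathbb{R}}f_+(y)f_-(x-y)\,dy$ is decreasing for $x\ge0$. ''Increasing'' and ''decreasing'' are meant in the weak sense. If $r=0$ the monotonicity hypothesis reduces to $f$ being decreasing on $[0,\infty)$. *)

(* Defs.v *)
From HB Require Import structures.
From mathcomp Require Import all_boot all_order all_algebra.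
From mathcomp Require Import all_classical all_reals all_analysis.

Set Implicit Arguments.
Unset Strict Implicit.
Unset Printing Implicit Defensive.

Import Order.TTheory GRing.Theory Num.Theory.
Import numFieldNormedType.Exports.

Local Open Scope classical_set_scope.
Local Open Scope ring_scope.

(* f_+ and f_-: these cut off the domain of f, unlike the library's f^\+ and
   f^\-, which cut off its values. *)
Definition right_half (R : realType) (f : R -> R) : R -> R :=
  f \* \1_[set x : R | 0 < x].

Definition left_half (R : realType) (f : R -> R) : R -> R :=
  f \* \1_[set x : R | x < 0].

(* Rintegral takes the junk value 0 when the integral is infinite; for f and g
   in L^2 the integrand is integrable for every x, by Cauchy-Schwarz. *)
Definition convolution (R : realType) (f g : R -> R) (x : R) : R :=
  Rintegral (@lebesgue_measure R) setT (fun y => f y * g (x - y)).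

Definition classS (R : realType) : set (R -> R) :=
  [set f | [/\ f \in Lfun (@lebesgue_measure R) 1%E,
     f \in Lfun (@lebesgue_measure R) 2%:E &
     {in `[0, +oo[ &,
        nonincreasing_fun (convolution (right_half f) (left_half f))}]].

(* Main.v *)
Require Import Defs.
From mathcomp Require Import all_boot all_order all_algebra.
From mathcomp Require Import all_classical all_reals all_analysis.
From mathcomp Require Import measurable_realfun ring lra.

Import Order.TTheory GRing.Theory Num.Theory.
Import numFieldNormedType.Exports.

Local Open Scope classical_set_scope.
Local Open Scope ring_scope.

(** Write [g] for [f_+].  As [f] is even, [f_-(x - y) = g(y - x)], so the
    convolution is the autocorrelation [A(x) = \int g(t) g(t - x) dt].  The
    hypotheses on [f] make [g] quasi-concave on the whole line: its superlevel
    sets are intervals, hence totally ordered by inclusion.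

    By the layer-cake formula [A(x)] is the integral over levels [s, u > 0] of
    the measure of [{t | s < g(t), u < g(t - x)}].  For fixed [t] and [s >= u],
    the condition [s < g(t)] puts [t] in the interval [{g > u}], so for
    [x >= 0] the truth of [u < g(t - x)] can only be lost as [x] grows: [t - x]
    starts inside the interval and moves away.  The part [s >= u] of the layer
    cake is thus nonincreasing pointwise in [t].  The part [s <= u] has the same
    property after the change of variable [t := t + x], with [t + x] moving to
    the right instead of [t - x] to the left.

    The levels need not appear in the proof, because the area of the relevant
    set of pairs [(s, u)] is an explicit function of the two values
    ([layer_area]): it splits their product ([layer_areaD]) and it depends on
    the second value only through their minimum, monotonically
    ([le_layer_area]), while quasi-concavity says exactly that
    [min (g t) (g (t + x))] is monotone as [x] moves away from [0].

    All integrands are non-negative, so the comparison takes place in the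
    extended reals; finiteness, needed to pass to the real-valued convolution,
    then follows from [A(x) <= A(0) <= \int f^2]. *)

(** The square [f ^+ 2 <= M * `|f|] is dominated by an integrable function. *)
Lemma bounded_Lfun1_Lfun2 d (T : measurableType d) (R : realType)
    (mu : {measure set T -> \bar R}) (f : T -> R) (M : R) :
  (forall x, `|f x| <= M) -> f \in Lfun mu 1%E -> f \in Lfun mu 2%:E.
Proof.
move=> fM /[dup] f1 /Lfun1_integrable intf.
have mf : measurable_fun setT f by apply/measurable_EFinP; case/integrableP: intf.
rewrite inE; apply/andP; split; rewrite inE//= /finite_norm unlock.
apply: poweR_lty.
have /integrableP[_ ] := integrableZl measurableT M intf.
apply: le_lt_trans; apply: ge0_le_integral => //.
- by move=> x _ /=; rewrite lee_fin powR_ge0.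
- apply/measurable_EFinP.
  apply: (@measurableT_comp _ _ _ _ _ _ (fun x : R => x `^ 2)) => //.
  exact: measurableT_comp.
- apply: measurableT_comp => //; apply/measurable_EFinP.
  exact: measurable_funM.
- move=> x _ /=; rewrite lee_fin powR_mulrn// normrM expr2 ler_wpM2r//.
  exact: le_trans (fM x) (ler_norm M).
Qed.

Lemma lebesgue_measure_addr (R : realType) (a : R) (A : set R) :
  measurable A ->
  pushforward lebesgue_measure
    ((fun t : R => t + a) : _ -> measurableTypeR R) A = lebesgue_measure A.
Proof.
move=> mA; apply/esym.
have ma : measurable_fun [set: measurableTypeR R]
    ((fun t : R => t + a) : _ -> measurableTypeR R).
  exact: measurable_funD.
(* A locally finite measure is determined by half-open intervals. *)
apply: (@lebesgue_measure_unique _ (pushforward lebesgue_measure _)) => //=.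
move=> _ [[b c]] _ <-.
rewrite /pushforward (_ : _ @^-1` _ = `]b - a, c - a]%classic); last first.
  by apply/seteqP; split=> x /=; rewrite !in_itv/= ltrBlDr lerBrDr.
rewrite !lebesgue_measure_itv/= !lte_fin ltrD2r.
by rewrite -!EFinB opprB addrA subrK.
Qed.

Lemma ge0_integral_addr (R : realType) (a : R) (F : R -> \bar R) :
  measurable_fun setT F -> (forall t, (0 <= F t)%E) ->
  (\int[@lebesgue_measure R]_t F (t + a)%R = \int[@lebesgue_measure R]_t F t)%E.
Proof.
move=> mF F0.
have ma : measurable_fun [set: measurableTypeR R]
    ((fun t : R => t + a) : _ -> measurableTypeR R).
  exact: measurable_funD.
rewrite -(ge0_integral_pushforward ma _ measurableT mF)//.
by apply: eq_measure_integral => A mA _; exact: lebesgue_measure_addr.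
Qed.

(** The area of the pairs [(s, u)] with [0 <= u <= s], [s < p], [u < q], for
    [p, q >= 0]. *)
Definition layer_area (R : realType) (p q : R) : R :=
  p * Num.min p q - Num.min p q ^+ 2 / 2.

(** The diagonal cuts the rectangle [p * q] into the two regions measured on the
    left. *)
Lemma layer_areaD (R : realType) (p q : R) :
  layer_area R p q + layer_area R q p = p * q.
Proof. by rewrite /layer_area (minC q p); case: (leP p q) => _; field. Qed.

Lemma layer_area_ge0 (R : realType) (p q : R) :
  0 <= p -> 0 <= q -> 0 <= layer_area R p q.
Proof. by move=> p0 q0; rewrite /layer_area; case: (leP p q) => pq; nra. Qed.

(** On [m <= p] the map [m |-> p * m - m ^+ 2 / 2] is nondecreasing. *)
Lemma le_layer_area (R : realType) (p q q' : R) :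
  Num.min p q <= Num.min p q' -> layer_area R p q <= layer_area R p q'.
Proof.
rewrite /layer_area; have : Num.min p q' <= p by rewrite ge_min lexx.
by move: (Num.min p q) (Num.min p q') => m m' m'p mm'; nra.
Qed.

Lemma measurable_layer_area (R : realType) (g h : R -> R) :
  measurable_fun setT g -> measurable_fun setT h ->
  measurable_fun setT (fun t => (layer_area R (g t) (h t))%:E).
Proof.
move=> mg mh; apply/measurable_EFinP; rewrite /layer_area.
have mm : measurable_fun setT (fun t => Num.min (g t) (h t)).
  exact: measurable_minr.
apply: measurable_funB; first exact: measurable_funM.
by apply: measurable_funM => //; exact: measurable_funX.
Qed.

Definition quasi_concave (R : realType) (g : R -> R) :=
  forall a b c, a <= b -> b <= c -> Num.min (g a) (g c) <= g b.

Definition autocorrelation (R : realType) (g : R -> R) (x : R) : \bar R :=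
  (\int[@lebesgue_measure R]_t (g t * g (t - x))%:E)%E.

(** Putting [g t] first in both terms, by translating the second one, makes each
    integrand depend on [x] only through the shifted value. *)
Lemma autocorrelation_layers (R : realType) (g : R -> R) (x : R) :
  measurable_fun setT g -> (forall t, 0 <= g t) ->
  autocorrelation R g x =
  (\int[@lebesgue_measure R]_t (layer_area R (g t) (g (t - x)))%:E +
   \int[@lebesgue_measure R]_t (layer_area R (g t) (g (t + x)))%:E)%E.
Proof.
move=> mg g0.
have mgD a : measurable_fun setT (fun t : R => g (t + a)).
  by apply: measurableT_comp => //; exact: measurable_funD.
rewrite /autocorrelation.
under eq_integral do rewrite -layer_areaD EFinD.
rewrite ge0_integralD//; last 4 first.
- by move=> t _; rewrite lee_fin layer_area_ge0.
- exact: measurable_layer_area.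
- by move=> t _; rewrite lee_fin layer_area_ge0.
- exact: measurable_layer_area.
congr (_ + _)%E.
rewrite -(ge0_integral_addr _ (- x)
  (fun t => (layer_area R (g t) (g (t + x)))%:E)).
- by apply: eq_integral => t _; rewrite subrK.
- exact: measurable_layer_area.
- by move=> t; rewrite lee_fin layer_area_ge0.
Qed.

(** Both integrands of [autocorrelation_layers] decrease pointwise: moving the
    shifted point further from [t] on the same side can only lower the minimum,
    as the nearer point lies between [t] and the farther one. *)
Lemma autocorrelation_nonincreasing (R : realType) (g : R -> R) (x y : R) :
  measurable_fun setT g -> (forall t, 0 <= g t) -> quasi_concave R g ->
  0 <= x -> x <= y -> (autocorrelation R g y <= autocorrelation R g x)%E.
Proof.
move=> mg g0 qg x0 xy.
have mgD a : measurable_fun setT (fun t : R => g (t + a)).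
  by apply: measurableT_comp => //; exact: measurable_funD.
rewrite !autocorrelation_layers//; apply: leeD; apply: ge0_le_integral => //.
- by move=> t _; rewrite lee_fin layer_area_ge0.
- exact: measurable_layer_area.
- exact: measurable_layer_area.
- move=> t _; rewrite lee_fin; apply: le_layer_area.
  by rewrite le_min ge_min lexx/= minC; apply: qg; lra.
- by move=> t _; rewrite lee_fin layer_area_ge0.
- exact: measurable_layer_area.
- exact: measurable_layer_area.
- move=> t _; rewrite lee_fin; apply: le_layer_area.
  by rewrite le_min ge_min lexx/=; apply: qg; lra.
Qed.

Lemma right_halfE (R : realType) (f : R -> R) (x : R) :
  right_half f x = if 0 < x then f x else 0.
Proof.
rewrite /right_half /= indicE.
have [x0|x0] := ltP 0 x; first by rewrite mem_set ?mulr1.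
by rewrite memNset ?mulr0//=; apply/negP; rewrite -leNgt.
Qed.

Lemma left_half_even (R : realType) (f : R -> R) (x : R) :
  (forall t, f (- t) = f t) -> left_half f x = right_half f (- x).
Proof.
move=> fe; rewrite right_halfE fe oppr_gt0 /left_half /= indicE.
have [x0|x0] := ltP x 0; first by rewrite mem_set ?mulr1.
by rewrite memNset ?mulr0//=; apply/negP; rewrite -leNgt.
Qed.

Lemma convolution_halves (R : realType) (f : R -> R) (x : R) :
  (forall t, f (- t) = f t) ->
  convolution (right_half f) (left_half f) x =
  fine (autocorrelation R (right_half f) x).
Proof.
move=> fe; rewrite /convolution /Rintegral; congr fine.
by apply: eq_integral => t _; rewrite left_half_even// opprB.
Qed.

Lemma right_half_quasi_concave (R : realType) (r : R) (f : R -> R) :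
  (forall x, 0 <= f x) -> {in `]0, r] &, nondecreasing_fun f} ->
  {in `[r, +oo[ &, nonincreasing_fun f} -> quasi_concave R (right_half f).
Proof.
move=> f0 fi fd a b c ab bc; rewrite !right_halfE.
have [a0|a0] := ltP 0 a; last first.
  by rewrite ge_min; apply/orP; left; case: ifP.
have b0 := lt_le_trans a0 ab; rewrite b0 (lt_le_trans b0 bc) ge_min.
have [br|/ltW rb] := leP b r; apply/orP; [left; apply: fi|right; apply: fd] => //.
- by rewrite in_itv/= a0 (le_trans ab).
- by rewrite in_itv/= b0.
- by rewrite in_itv/= andbT.
- by rewrite in_itv/= andbT (le_trans rb).
Qed.

(** The bound on a half-line is the value at the mode [r]; the value [f 0] is
    separate since monotonicity says nothing about it when [r > 0]. *)
Lemma even_unimodal_bounded (R : realType) (r : R) (f : R -> R) (x : R) :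
  0 <= r -> (forall t, f (- t) = f t) ->
  {in `]0, r] &, nondecreasing_fun f} ->
  {in `[r, +oo[ &, nonincreasing_fun f} -> f x <= Num.max (f 0) (f r).
Proof.
move=> r0 fe fi fd; rewrite le_max.
wlog x0 : x / 0 <= x.
  by move=> H; have [/H//|/ltW x0] := leP 0 x; rewrite -fe H// oppr_ge0.
have [->|xn0] := eqVneq x 0; first by rewrite lexx.
have {xn0 x0} x0 : 0 < x by rewrite lt_neqAle eq_sym xn0.
apply/orP; right; have [xr|/ltW rx] := leP x r.
- by apply: fi => //; rewrite in_itv/= ?lexx ?x0 ?xr ?(lt_le_trans x0 xr).
- by apply: fd => //; rewrite in_itv/= ?lexx ?rx.
Qed.

Theorem proposition3p5 (R : realType) (r : R) (f : R -> R)
  (r_ge0 : 0 <= r)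
  (f_L1 : f \in Lfun (@lebesgue_measure R) 1%E)
  (f_Loo : f \in Lfun (@lebesgue_measure R) +oo%E)
  (f_even : forall x : R, f (- x) = f x)
  (f_ge0 : forall x : R, 0 <= f x)
  (f_incr : {in `]0, r] &, nondecreasing_fun f})
  (f_decr : {in `[r, +oo[ &, nonincreasing_fun f}) :
  classS f.
Proof.
have f_L2 : f \in Lfun (@lebesgue_measure R) 2%:E.
  apply: (bounded_Lfun1_Lfun2 _ _ _ _ _ (Num.max (f 0) (f r))) f_L1 => x.
  by rewrite ger0_norm//; exact: even_unimodal_bounded.
split=> // x y; rewrite !in_itv/= !andbT => x0 y0 xy.
have mf : measurable_fun setT f.
  by move/Lfun1_integrable/integrableP : f_L1 => [/measurable_EFinP].
set g := right_half f.
have mg : measurable_fun setT g.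
  apply: measurable_funM => //; apply: measurable_indic.
  by rewrite -set_itvoy; exact: measurable_itv.
have g0 t : 0 <= g t by rewrite /g right_halfE; case: ifP.
have qg : quasi_concave R g := right_half_quasi_concave R r f f_ge0 f_incr f_decr.
have A_fin z : 0 <= z -> autocorrelation R g z \is a fin_num.
  move=> z0; rewrite ge0_fin_numE; last first.
    by apply: integral_ge0 => t _; rewrite lee_fin mulr_ge0.
  apply: le_lt_trans (autocorrelation_nonincreasing _ _ _ _ mg g0 qg (lexx 0) z0) _.
  have /integrableP[_] := Lfun2_integrable_sqr f_L2.
  apply: le_lt_trans; apply: ge0_le_integral => //.
  - by move=> t _; rewrite lee_fin mulr_ge0.
  - apply/measurable_EFinP; apply: measurable_funM => //.
    by apply: measurableT_comp => //; exact: measurable_funD.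
  - by do 2 apply: measurableT_comp => //; exact: measurable_funX.
  - move=> t _ /=; rewrite lee_fin subr0 -expr2 ger0_norm ?sqr_ge0// lerXn2r ?nnegrE//.
    by rewrite /g right_halfE; case: ifP.
rewrite !convolution_halves//; apply: fine_le; rewrite ?A_fin//.
exact: autocorrelation_nonincreasing.
Qed.
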